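(* Up to transduction equivalence, the class $\mathscr G$ of all graphs is the only class that is a $\sqsubseteq_{\rm FO}$-upper bound for all classes with bounded expansion. That is, $\mathscr G$ satisfies $\mathscr C\sqsubseteq_{\rm FO}\mathscr G$ for every class $\mathscr C$ with bounded expansion, and every class of graphs $\mathscr B$ such that $\mathscr C\sqsubseteq_{\rm FO}\mathscr B$ holds for every class $\mathscr C$ with bounded expansion satisfies $\mathscr B\equiv_{\rm FO}\mathscr G$.
   Context: Graphs are finite, undirected and loopless; a class of graphs is a set of graphs considered up to isomorphism, and every class contains the empty graph. For a set $\mathcal U$ of unary relation symbols, a $\mathcal U$-colored graph is a graph with additional unary relations in $\mathcal U$. Formulas are first-order, with adjacency relation $E$. Bounded expansion. A depth-$r$ minor of a graph $G$ is a graph obtained from $G$ by contracting vertex-disjoint connected subgraphs of radius at most $r$ and deleting a subset of edges and vertices. A class $\mathscr C$ has bounded expansion if there is a function $f:\mathbb N\to\mathbb N$ such that, for every integer $r$, all depth-$r$ minors of graphs in $\mathscr C$ have average degree at most $f(r)$. Transductions. For a positive integer $k$, the $k$-copy operation $\mathsf C_k$ maps a graph $G$ to the graph consisting of $k$ copies of $G$ in which the $k$ copies of each vertex are made pairwise adjacent (no other edges between the copies). The coloring operation $\Gamma_{\mathcal U}$ maps a graph to the set of all its $\mathcal U$-expansions. A simple interpretation $\mathsf I=(\nu(x),\eta(x,y))$ of graphs in $\mathcal U$-colored graphs is a pair of first-order formulas with $\eta$ symmetric and anti-reflexive; $\mathsf I(G^+)$ is the graph with vertex set $\nu(G^+)$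 and edge set $\eta(G^+)\cap\nu(G^+)^2$. A transduction is a composition $\mathsf T=\mathsf I\circ\Gamma_{\mathcal U}\circ\mathsf C_k$, so $\mathsf T(G)=\{\mathsf I(G^+): G^+\in\Gamma_{\mathcal U}(\mathsf C_k(G))\}$. For a class $\mathscr D$, $\mathsf T(\mathscr D)=\bigcup_{G\in\mathscr D}\mathsf T(G)$ up to isomorphism. $\mathscr C\sqsubseteq_{\rm FO}\mathscr D$ means $\mathscr C\subseteq\mathsf T(\mathscr D)$ for some transduction $\mathsf T$; $\mathscr C\equiv_{\rm FO}\mathscr D$ (transduction equivalence) means $\mathscr C\sqsubseteq_{\rm FO}\mathscr D$ and $\mathscr D\sqsubseteq_{\rm FO}\mathscr C$. *)

(* Defs.v *)
From mathcomp Require Import all_boot all_order all_algebra.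

Set Implicit Arguments.
Unset Strict Implicit.
Unset Printing Implicit Defensive.

Record sgraph := SGraph {
  vertex :> finType;
  adj : rel vertex;
  adj_sym : symmetric adj;
  adj_irr : irreflexive adj
}.

Definition graph_iso (G H : sgraph) : Prop :=
  exists2 f : G -> H, bijective f & forall x y : G, adj (f x) (f y) = adj x y.

Definition empty_graph : sgraph :=
  @SGraph void (fun _ _ => false) (fun _ _ => erefl) (fun _ => erefl).

Record graph_class := GraphClass {
  class_mem :> sgraph -> Prop;
  class_iso : forall G H : sgraph, graph_iso G H -> class_mem G -> class_mem H;
  class_empty : class_mem empty_graph
}.

Definition all_graphs : graph_class :=
  @GraphClass (fun _ => True) (fun _ _ _ _ => I) I.

(* The subgraph of G induced by A is connected and has radius at most r: walks
   inside A of length at most r lead from some center to every vertex of A. *)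
Definition connected_radius_le (G : sgraph) (r : nat) (A : {set G}) : Prop :=
  exists2 c : G, c \in A & forall v : G, v \in A ->
    exists p : seq G,
      [/\ path (fun x y : G => [&& x \in A, y \in A & adj x y]) c p,
          last c p = v & size p <= r].

Section Contraction.

Variables (G : sgraph) (P : {set {set G}}).

Definition contract_adj : rel {B : {set G} | B \in P} :=
  fun B C => (B != C) && [exists x in val B, exists y in val C, adj x y].

Lemma contract_sym : symmetric contract_adj.
Proof.
move=> B C; rewrite /contract_adj eq_sym; congr (_ && _).
by apply/exists_inP/exists_inP => -[x Bx /exists_inP[y Cy xy]];
  exists y => //; apply/exists_inP; exists x; rewrite // adj_sym.
Qed.

Lemma contract_irr : irreflexive contract_adj.
Proof. by move=> B; rewrite /contract_adj eqxx. Qed.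

Definition contract : sgraph := SGraph contract_sym contract_irr.

End Contraction.

(* H is, up to isomorphism, obtained from G by deleting vertices and edges. *)
Definition subgraph (H G : sgraph) : Prop :=
  exists2 f : H -> G, injective f & forall x y : H, adj x y -> adj (f x) (f y).

(* The contracted subgraphs are the blocks of a partition of the whole vertex
   set: a vertex that takes part in no contraction is a singleton block, of
   radius 0. *)
Definition depth_minor (r : nat) (H G : sgraph) : Prop :=
  exists P : {set {set G}},
    [/\ partition P [set: G],
        forall A : {set G}, A \in P -> connected_radius_le r A
      & subgraph H (contract P)].

Definition degree (G : sgraph) (x : G) : nat := #|[set y : G | adj x y]|.

(* The empty graph has average degree 0 / 0 = 0. *)
Definition average_degree (G : sgraph) : rat :=
  ((\sum_(x : G) degree x)%N%:R / #|G|%:R)%R.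

Definition bounded_expansion (C : graph_class) : Prop :=
  exists f : nat -> nat, forall (r : nat) (G H : sgraph),
    C G -> depth_minor r H G -> (average_degree H <= (f r)%:R)%R.

Record colored_graph (U : Type) := ColoredGraph {
  base :> sgraph;
  color : U -> {set base}
}.

(* Formulas with free variables among x_0, ..., x_(n-1); the quantifier binds
   x_0 and shifts the other variables by one. *)
Inductive formula (U : Type) : nat -> Type :=
| FEq n of 'I_n & 'I_n : formula U n
| FAdj n of 'I_n & 'I_n : formula U n
| FColor n of U & 'I_n : formula U n
| FNot n of formula U n : formula U n
| FAnd n of formula U n & formula U n : formula U n
| FExists n of formula U n.+1 : formula U n.

Fixpoint holds (U : Type) (G : colored_graph U) (n : nat) (phi : formula U n) :
    n.-tuple G -> bool :=
  match phi in formula _ n return n.-tuple G -> bool with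
  | FEq _ i j => fun e => tnth e i == tnth e j
  | FAdj _ i j => fun e => adj (tnth e i) (tnth e j)
  | FColor _ u i => fun e => tnth e i \in color G u
  | FNot _ f => fun e => ~~ holds f e
  | FAnd _ f g => fun e => holds f e && holds g e
  | FExists _ f => fun e => [exists x : G, holds f [tuple of x :: e]]
  end.

Section Copy.

Variables (k : nat) (G : sgraph).

Definition copy_adj : rel ('I_k * G) := fun u v =>
  if u.1 == v.1 then adj u.2 v.2 else u.2 == v.2.

Lemma copy_sym : symmetric copy_adj.
Proof.
by move=> u v; rewrite /copy_adj (eq_sym v.1) (eq_sym v.2) (adj_sym v.2).
Qed.

Lemma copy_irr : irreflexive copy_adj.
Proof. by move=> u; rewrite /copy_adj eqxx adj_irr. Qed.

Definition copy : sgraph := SGraph copy_sym copy_irr.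

End Copy.

Record interpretation (U : Type) := Interpretation {
  nu : formula U 1;
  eta : formula U 2;
  eta_sym : forall G : colored_graph U,
    symmetric (fun x y : G => holds eta [tuple x; y]);
  eta_irr : forall G : colored_graph U,
    irreflexive (fun x y : G => holds eta [tuple x; y])
}.

Section Interpret.

Variables (U : Type) (J : interpretation U) (G : colored_graph U).

Definition interpret_adj : rel {x : G | holds (nu J) [tuple x]} :=
  fun x y => holds (eta J) [tuple val x; val y].

Lemma interpret_sym : symmetric interpret_adj.
Proof. by move=> x y; apply: (eta_sym J (val x) (val y)). Qed.

Lemma interpret_irr : irreflexive interpret_adj.
Proof. by move=> x; apply: (eta_irr J (val x)). Qed.

Definition interpret : sgraph := SGraph interpret_sym interpret_irr.

End Interpret.

Record transduction := Transduction {
  copies : nat;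
  copies_gt0 : 0 < copies;
  colors : Type;
  interp : interpretation colors
}.

Definition transduction_image (T : transduction) (D : sgraph -> Prop)
    (H : sgraph) : Prop :=
  exists2 G : sgraph, D G &
  exists c : colors T -> {set copy (copies T) G},
    graph_iso H (interpret (interp T) (ColoredGraph c)).

Definition fo_le (C D : graph_class) : Prop :=
  exists T : transduction, forall G : sgraph, C G -> transduction_image T D G.

Definition fo_equiv (C D : graph_class) : Prop := fo_le C D /\ fo_le D C.

(* Main.v *)
Require Import Defs.
From mathcomp Require Import all_boot all_order all_algebra.
From mathcomp Require Import zify.
From Stdlib Require Import Classical ClassicalEpsilon.

(* Suppose some transduction-upper bound B does not transduce the class of all
   graphs.  There are only countably many transductions T_n, and from the
   (n+1)-subdivision of a graph H one recovers H by a transduction that does not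
   depend on H: mark the original vertices and join two of them whenever a walk
   through n+1 unmarked vertices links them.  Hence for every n there is a graph
   H_n whose (n+1)-subdivision is not in T_n(B).  These subdivisions, one for
   each n, form a class with bounded expansion whatever the sizes of the H_n: for
   4r <= n, in a depth-r minor no two blocks containing original vertices are
   adjacent, and the other blocks have bounded size; the remaining finitely many
   graphs are harmless.  But by construction no T_n transduces this class from
   B. *)

Set Implicit Arguments.
Unset Strict Implicit.
Unset Printing Implicit Defensive.

(** * Renaming of variables and colors in formulas *)

Definition lift_var n m (f : 'I_n -> 'I_m) (i : 'I_n.+1) : 'I_m.+1 :=
  oapp (fun j => lift ord0 (f j)) ord0 (unlift ord0 i).

Fixpoint rename (U V : Type) (g : U -> V) n (phi : formula U n) :
    forall m, ('I_n -> 'I_m) -> formula V m :=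
  match phi in formula _ n return forall m, ('I_n -> 'I_m) -> formula V m with
  | FEq _ i j => fun m f => FEq V (f i) (f j)
  | FAdj _ i j => fun m f => FAdj V (f i) (f j)
  | FColor _ u i => fun m f => FColor (g u) (f i)
  | FNot _ a => fun m f => FNot (rename g a f)
  | FAnd _ a b => fun m f => FAnd (rename g a f) (rename g b f)
  | FExists _ a => fun m f => FExists (rename g a (lift_var f))
  end.

Fixpoint colors_of (U : Type) n (phi : formula U n) : list U :=
  match phi with
  | FColor _ u _ => [:: u]
  | FNot _ a => colors_of a
  | FAnd _ a b => colors_of a ++ colors_of b
  | FExists _ a => colors_of a
  | _ => [::]
  end.

(** Agreement is asked only for the finitely many colors that occur in [phi], so that an arbitrary
    color type can be traded for [nat]. As [f] is arbitrary, substitution of variables is covered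
    too. *)
Lemma holds_rename (U V : Type) (g : U -> V) (G : sgraph)
    (c : U -> {set G}) (c' : V -> {set G}) n (phi : formula U n) :
  (forall u, List.In u (colors_of phi) -> c' (g u) = c u) ->
  forall m (f : 'I_n -> 'I_m) (e : n.-tuple G) (e' : m.-tuple G),
  (forall i, tnth e i = tnth e' (f i)) ->
  holds (G := ColoredGraph c') (rename g phi f) e'
  = holds (G := ColoredGraph c) phi e.
Proof.
elim: phi => {n} [n i j|n i j|n u i|n a IHa|n a IHa b IHb|n a IHa] /= cc m f e e' ee'.
- by rewrite !ee'.
- by rewrite !ee'.
- by rewrite ee' cc //; left.
- by rewrite (IHa cc _ _ e).
- have ca u : List.In u (colors_of a) -> c' (g u) = c u.
    by move=> ua; apply/cc/List.in_or_app; left.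
  have cb u : List.In u (colors_of b) -> c' (g u) = c u.
    by move=> ub; apply/cc/List.in_or_app; right.
  by rewrite (IHa ca _ _ e) ?(IHb cb _ _ e).
- apply: eq_existsb => x; apply: IHa => // i.
  rewrite /lift_var; case: unliftP => [j|] ->; first by rewrite /= !tnthS.
  by rewrite !tnth0.
Qed.

(** The numbering [g] precedes the coloring [c], since a transduction is fixed before its input.
    Equality on [U] is decided by excluded middle. *)
Lemma color_numbering (U : Type) (l : list U) :
  exists g : U -> nat, forall (X : Type) (x0 : X) (c : U -> X),
    exists c' : nat -> X, forall u, List.In u l -> c' (g u) = c u.
Proof.
elim: l => [|u l [g gP]].
  by exists (fun=> 0) => X x0 c; exists (fun=> x0).
exists (fun v => if excluded_middle_informative (v = u) then 0 else (g v).+1).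
move=> X x0 c; have [c' c'P] := gP X x0 c.
exists (fun n => if n is m.+1 then c' m else c u) => v /= uvl.
case: excluded_middle_informative => [vu|vu] /=; first by rewrite vu.
by case: uvl => [uv|/c'P//]; case: vu.
Qed.

(** * The identity transduction *)

Definition identity_transduction : transduction :=
  Transduction (ltn0Sn 0)
    (@Interpretation void (FEq void ord0 ord0) (FAdj void ord0 (lift ord0 ord0))
      (fun G x y => adj_sym x y) (fun G x => adj_irr x)).

Lemma fo_le_subclass (C D : graph_class) :
  (forall G, C G -> D G) -> fo_le C D.
Proof.
move=> CD; exists identity_transduction => G /CD DG; exists G => //.
exists (fun _ => set0).
have top (x : 'I_1 * G) : tnth [tuple x] ord0 == tnth [tuple x] ord0 by [].
exists (fun x => exist _ (ord0, x) (top (ord0, x))).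
  exists (fun y => (val y).2) => // [[[i x] p]].
  by apply: val_inj; rewrite /= (ord1 i).
by move=> x y.
Qed.

(** * Countability of transductions *)

(** [GenTree.tree nat] is a countable type. The number of free variables is not stored; the decoder
    receives it as an argument. *)
Fixpoint tree_of_formula n (phi : formula nat n) : GenTree.tree nat :=
  match phi with
  | FEq _ i j => GenTree.Node 0 [:: GenTree.Leaf (i : nat); GenTree.Leaf (j : nat)]
  | FAdj _ i j => GenTree.Node 1 [:: GenTree.Leaf (i : nat); GenTree.Leaf (j : nat)]
  | FColor _ u i => GenTree.Node 2 [:: GenTree.Leaf u; GenTree.Leaf (i : nat)]
  | FNot _ a => GenTree.Node 3 [:: tree_of_formula a]
  | FAnd _ a b => GenTree.Node 4 [:: tree_of_formula a; tree_of_formula b]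
  | FExists _ a => GenTree.Node 5 [:: tree_of_formula a]
  end.

Fixpoint formula_of_tree (t : GenTree.tree nat) n : option (formula nat n) :=
  match t with
  | GenTree.Node 0 [:: GenTree.Leaf i; GenTree.Leaf j] =>
      obind (fun i => omap (FEq nat i) (insub j)) (insub i)
  | GenTree.Node 1 [:: GenTree.Leaf i; GenTree.Leaf j] =>
      obind (fun i => omap (FAdj nat i) (insub j)) (insub i)
  | GenTree.Node 2 [:: GenTree.Leaf u; GenTree.Leaf i] =>
      omap (FColor u) (insub i)
  | GenTree.Node 3 [:: a] => omap (@FNot nat n) (formula_of_tree a n)
  | GenTree.Node 4 [:: a; b] =>
      obind (fun a => omap (FAnd a) (formula_of_tree b n)) (formula_of_tree a n)
  | GenTree.Node 5 [:: a] => omap (@FExists nat n) (formula_of_tree a n.+1)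
  | _ => None
  end.

Lemma tree_of_formulaK n (phi : formula nat n) :
  formula_of_tree (tree_of_formula phi) n = Some phi.
Proof.
elim: phi => {n} [n i j|n i j|n u i|n a IHa|n a IHa b IHb|n a IHa] /=;
  by rewrite ?valK ?IHa ?IHb /= ?valK.
Qed.

Lemma tree_of_formula_inj n : injective (@tree_of_formula n).
Proof.
by move=> a b ab; apply: Some_inj; rewrite -!tree_of_formulaK ab.
Qed.

Definition interpretation_code (J : interpretation nat) : GenTree.tree nat :=
  GenTree.Node 0 [:: tree_of_formula (nu J); tree_of_formula (eta J)].

Lemma interpretation_code_inj : injective interpretation_code.
Proof.
move=> [a b s i] [a' b' s' i'] [/tree_of_formula_inj/= aa /tree_of_formula_inj/= bb].
by subst; congr Interpretation; apply: proof_irrelevance.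
Qed.

(** Color types are arbitrary, so the transductions themselves cannot be enumerated; but two
    formulas mention finitely many colors, which can be numbered. *)
Lemma transduction_nat_colors (T : transduction) :
  exists J : interpretation nat, forall (D : sgraph -> Prop) H,
    transduction_image T D H ->
    transduction_image (Transduction (copies_gt0 T) J) D H.
Proof.
case: T => k k0 U [a b bS bI] /=.
have [g gP] := color_numbering (colors_of a ++ colors_of b).
pose a' := rename g a id; pose b' := rename g b id.
(* Every [nat]-colored graph is read as a [U]-colored one along [g]; thus [b'] inherits symmetry and
   irreflexivity on all inputs. *)
have b'E (G : colored_graph nat) x y : holds (G := G) b' [tuple x; y] =
    holds (G := ColoredGraph (fun u => color G (g u))) b [tuple x; y].
  by case: G x y => G c x y; exact: holds_rename.
have b'S (G : colored_graph nat) :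
    symmetric (fun x y : G => holds (G := G) b' [tuple x; y]).
  by move=> x y; rewrite !b'E; apply: bS.
have b'I (G : colored_graph nat) :
    irreflexive (fun x y : G => holds (G := G) b' [tuple x; y]).
  by move=> x; rewrite b'E; apply: bI.
exists (@Interpretation nat a' b' b'S b'I) => D H [G DG [c [f fbij fadj]]].
exists G => //=.
have [c' c'P] := gP _ set0 c; exists c'.
have aE x : holds (G := ColoredGraph c') a' [tuple x]
          = holds (G := ColoredGraph c) a [tuple x].
  by apply: holds_rename => // u ua; apply/c'P/List.in_or_app; left.
have bE x y : holds (G := ColoredGraph c') b' [tuple x; y]
            = holds (G := ColoredGraph c) b [tuple x; y].
  by apply: holds_rename => // u ub; apply/c'P/List.in_or_app; right.
have [f' fK f'K] := fbij.
have v x : holds (G := ColoredGraph c') a' [tuple val (f x)].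
  by rewrite aE; exact: (valP (f x)).
have w (y : interpret (@Interpretation nat a' b' b'S b'I) (ColoredGraph c')) :
    holds (G := ColoredGraph c) a [tuple val y].
  by rewrite -aE; exact: (valP y).
exists (fun x => exist _ (val (f x)) (v x)).
  exists (fun y => f' (exist _ (val y) (w y))) => x.
    by rewrite -[RHS]fK; congr f'; apply: val_inj.
  by apply: val_inj; rewrite /= f'K.
by move=> x y; rewrite -fadj; apply: bE.
Qed.

Lemma transduction_enumeration :
  exists en : nat -> transduction, forall T : transduction,
    exists n, forall (D : sgraph -> Prop) H,
      transduction_image T D H -> transduction_image (en n) D H.
Proof.
pose code (k : nat) J := pickle (k, interpretation_code J).
(* Numbers that code no transduction get the identity as a default. *)
have ex n : exists T : transduction, forall k (k0 : 0 < k) J, code k J = n ->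
    Transduction k0 J = T.
  have [[k [k0 [J cJ]]]|no] :=
    classic (exists k (k0 : 0 < k) J, code k J = n).
  - exists (Transduction k0 J) => k' k0' J'; rewrite -{}cJ.
    move=> /(pcan_inj pickleK) kJ.
    have /= kk := congr1 fst kJ; have /= /interpretation_code_inj-> := congr1 snd kJ.
    by subst k'; rewrite (bool_irrelevance k0' k0).
  - by exists identity_transduction => k k0 J cJ; case: no; exists k, k0, J.
exists (fun n => sval (constructive_indefinite_description _ (ex n))) => T.
have [J JT] := transduction_nat_colors T.
exists (code (copies T) J) => D H /JT; set w := Transduction _ _.
case: constructive_indefinite_description => T' /= /(_ _ (copies_gt0 T) J erefl).
by move=> <-.
Qed.

(** * Subdivisions of graphs *)

(** Here [k] counts the inner vertices, so the walk has [k.+1] edges; its two ends may be old. *)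
Fixpoint inner_walk (G : sgraph) (old : pred G) (k : nat) : rel G :=
  if k is k'.+1 then
    fun x y => [exists z, [&& ~~ old z, adj x z & inner_walk old k' z y]]
  else @adj G.

Section Subdivision.

Variables (n : nat) (H : sgraph).

(* Subdivision vertices are created for all ordered pairs and all lie on paths;
   only those of edges are attached to their end points.  Hence every edge
   xy gives rise to two paths, one for (x, y) and one for (y, x). *)
Definition subdiv_vertex : finType := (H + (H * H) * 'I_n.+1)%type.

Definition attached (x : H) (e : H * H) (i : 'I_n.+1) : bool :=
  adj e.1 e.2 && ((x == e.1) && (i == 0 :> nat) || (x == e.2) && (i == n :> nat)).

Definition subdiv_adj : rel subdiv_vertex := fun u v =>
  match u, v with
  | inl _, inl _ => false
  | inl x, inr (e, i) => attached x e i
  | inr (e, i), inl x => attached x e i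
  | inr (e, i), inr (e', j) =>
      (e == e') && ((i == j.+1 :> nat) || (j == i.+1 :> nat))
  end.

Lemma subdiv_sym : symmetric subdiv_adj.
Proof.
by move=> [x|[e i]] [y|[e' j]] //=; rewrite eq_sym orbC.
Qed.

Lemma subdiv_irr : irreflexive subdiv_adj.
Proof.
by move=> [x|[e i]] //=; apply/negbTE; rewrite eqxx; lia.
Qed.

Definition subdiv : sgraph := SGraph subdiv_sym subdiv_irr.

Definition original (u : subdiv) : bool := if u is inl _ then true else false.

Lemma inner_walk_ends k (e : H * H) (i : 'I_n.+1) (b : H) :
  inner_walk original k (inr (e, i)) (inl b) ->
  adj e.1 e.2 /\ (b = e.1 \/ b = e.2).
Proof.
elim: k e i => [|k IHk] e i /=.
  by case/andP=> -> /orP[]/andP[/eqP-> _]; split=> //; [left|right].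
by case/existsP=> -[z|[e' j]] //= /andP[/andP[/eqP-> _]]; apply: IHk.
Qed.

(** The first step enters the path of some edge [e] at an end of [e], and the path can be left only
    at an end of [e]. A walk may turn back inside the path and return to [a], hence [a != b]. *)
Lemma inner_walk_adj k (a b : H) :
  a != b -> inner_walk original k (inl a) (inl b) -> adj a b.
Proof.
case: k => [|k] //= ab /existsP[[z|[e j]]] //= /andP[/andP[_ aej]].
move=> /inner_walk_ends[ee be].
have ae : a = e.1 \/ a = e.2 by case/orP: aej => /andP[/eqP->]; [left|right].
case: ae be ab ee => -> [->|->]; rewrite ?eqxx // => _; by rewrite 1?adj_sym.
Qed.

Lemma adj_inner_walk (a b : H) :
  adj a b -> inner_walk original n.+1 (inl a) (inl b).
Proof.
move=> ab; apply/existsP; exists (inr ((a, b), ord0)).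
rewrite /= /attached /= ab eqxx /=.
(* Generalized to a start at position [i], with [k = n - i] inner vertices still ahead. *)
have aux k (i : 'I_n.+1) : i + k = n ->
    inner_walk original k (inr ((a, b), i)) (inl b).
  elim: k i => [|k IHk] i ik /=.
    have iE : i = n :> nat by lia.
    by rewrite /attached /= ab iE !eqxx orbT.
  have lti : i.+1 < n.+1 by lia.
  apply/existsP; exists (inr ((a, b), Ordinal lti)).
  by rewrite /= !eqxx orbT IHk // -[RHS]ik /= addnS.
exact: aux.
Qed.

Lemma degree_subdivision_vertex (u : subdiv) :
  ~~ original u -> degree u <= 2.
Proof.
case: u => [//|[e i]] _.
(* The predecessor and the successor on the path of [e], with the ends of [e] beyond the extreme
   positions. *)
pose p : subdiv := if i == 0 :> nat then inl e.1 else inr (e, inord i.-1).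
pose q : subdiv := if i == n :> nat then inl e.2 else inr (e, inord i.+1).
suff sub : [set v | adj (inr (e, i) : subdiv) v] \subset [set p; q].
  by rewrite (leq_trans (subset_leq_card sub)) // cards2; case: eqP.
apply/subsetP => -[x|[e' j]]; rewrite !inE /=.
  rewrite /p /q => /andP[_ /orP[]/andP[/eqP-> ->]]; by rewrite eqxx ?orbT.
have ltj := ltn_ord j.
case/andP=> /eqP<- /orP[] /eqP ij; apply/orP; [left|right]; rewrite /p /q.
  by rewrite ij /= inord_val.
have -> : (i == n :> nat) = false by apply/eqP; lia.
by rewrite -ij inord_val.
Qed.

(* A 1-Lipschitz lower bound for the distance to [inl a]. *)
Definition distance_to (a : H) (u : subdiv) : nat :=
  match u with
  | inl b => if b == a then 0 else n.+2
  | inr (e, i) => minn (if e.1 == a then i.+1 else n.+2)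
                       (if e.2 == a then n.+1 - i else n.+2)
  end.

(** Position [i] lies [i + 1] steps from [e.1] and [n + 1 - i] steps from [e.2]; the cap [n + 2] is
    the length of a subdivided edge. *)
Lemma distance_to_adj a (u v : subdiv) :
  adj u v -> distance_to a v <= (distance_to a u).+1.
Proof.
case: u v => [x|[e i]] [y|[e' j]] //=.
- have ltj := ltn_ord j.
  case/andP=> _ /orP[]/andP[/eqP-> /eqP->]; do 2!case: eqP => ?; lia.
- have lti := ltn_ord i.
  case/andP=> _ /orP[]/andP[/eqP-> /eqP->]; do 2!case: eqP => ?; lia.
- have lti := ltn_ord i; have ltj := ltn_ord j.
  case/andP=> /eqP<- ij; do 2!case: eqP => ?; lia.
Qed.

Lemma original_far (u v : subdiv) (p : seq subdiv) :
  original u -> original v -> u != v -> path (@adj subdiv) u p -> last u p = v ->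
  n.+1 < size p.
Proof.
case: u v => [a|//] [b|//] _ _ ab up lp.
have: distance_to a (last (inl a : subdiv) p)
      <= distance_to a (inl a : subdiv) + size p.
  elim: p (inl a : subdiv) up {lp} => [|v p IHp] u /=; first by rewrite addn0.
  case/andP=> /(distance_to_adj a) uv /IHp/leq_trans; apply.
  by rewrite addnS -addSn leq_add2r.
rewrite lp /= eqxx; case: eqP => [ba|_] //.
by rewrite ba eqxx in ab.
Qed.

End Subdivision.

(** * Recovering a graph from its subdivision *)

Section Recover.

Variables (U : Type) (J : interpretation U).

Definition pair_var m (i j : 'I_m) (t : 'I_2) : 'I_m :=
  if val t is 0 then i else j.

(** The colors of [J] are embedded by [Some]; the fresh color [None] marks the original vertices. *)
Definition vertex_formula m (i : 'I_m) : formula (option U) m :=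
  rename Some (nu J) (fun=> i).

Definition adj_formula m (i j : 'I_m) : formula (option U) m :=
  rename Some (eta J) (pair_var i j).

Definition marked m (i : 'I_m) : formula (option U) m := FColor None i.

(** First-order form of [inner_walk] in the graph interpreted by [J]: the quantifier is relativized
    to [nu J]. Under the binder, the two free variables have indices 1 and 2. *)
Fixpoint walk_formula (k : nat) : formula (option U) 2 :=
  if k is k'.+1 then
    let z := ord0 : 'I_3 in let x := inord 1 : 'I_3 in let y := inord 2 : 'I_3 in
    FExists (FAnd (FAnd (vertex_formula z) (FNot (marked z)))
      (FAnd (adj_formula x z) (rename id (walk_formula k') (pair_var z y))))
  else adj_formula ord0 ord_max.

Definition recover_nu : formula (option U) 1 :=
  FAnd (vertex_formula ord0) (marked ord0).

(** Both directions are joined and the diagonal is removed because an interpretation must be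
    symmetric and irreflexive on every colored graph, not only on those that yield subdivisions. *)
Definition recover_eta k : formula (option U) 2 :=
  let x := ord0 in let y := ord_max in
  let w := walk_formula k in
  FAnd (FNot (FEq (option U) x y))
    (FNot (FAnd (FNot w) (FNot (rename id w (pair_var y x))))).

Lemma tnth_pair (T : Type) m (e : m.-tuple T) (i j : 'I_m) x y :
  tnth e i = x -> tnth e j = y ->
  forall t, tnth [tuple x; y] t = tnth e (pair_var i j t).
Proof. by move=> <- <- [[|[|//]] ?]; rewrite (tnth_nth (tnth e i)). Qed.

Lemma holds_swap (V : Type) (G : colored_graph V) (phi : formula V 2) x y :
  holds (G := G) (rename id phi (pair_var ord_max ord0)) [tuple x; y]
  = holds (G := G) phi [tuple y; x].
Proof.
case: G x y => G c x y; apply: (@holds_rename _ _ _ _ c) => //.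
exact: tnth_pair.
Qed.

Lemma holds_recover_eta k (G : colored_graph (option U)) x y :
  holds (G := G) (recover_eta k) [tuple x; y]
  = (x != y) && (holds (G := G) (walk_formula k) [tuple x; y]
                 || holds (G := G) (walk_formula k) [tuple y; x]).
Proof. by rewrite /= holds_swap negb_and !negbK. Qed.

Lemma recover_eta_sym k (G : colored_graph (option U)) :
  symmetric (fun x y : G => holds (G := G) (recover_eta k) [tuple x; y]).
Proof. by move=> x y; rewrite !holds_recover_eta eq_sym orbC. Qed.

Lemma recover_eta_irr k (G : colored_graph (option U)) :
  irreflexive (fun x y : G => holds (G := G) (recover_eta k) [tuple x; y]).
Proof. by move=> x; rewrite holds_recover_eta eqxx. Qed.

Definition recover_interpretation k : interpretation (option U) :=
  @Interpretation _ recover_nu (recover_eta k)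
    (recover_eta_sym k) (recover_eta_irr k).

Lemma holds_walk_formula (M S : sgraph) (c : U -> {set M}) (old : pred S)
    (f : S -> interpret J (ColoredGraph c)) (X : {set M}) k x y :
  bijective f -> (forall x y, adj (f x) (f y) = adj x y) ->
  (forall x, (val (f x) \in X) = old x) ->
  holds (G := ColoredGraph (oapp c X)) (walk_formula k)
    [tuple val (f x); val (f y)] = inner_walk old k x y.
Proof.
move=> [g fK gK] fadj Xold; elim: k x => [|k IHk] x /=.
  rewrite -fadj; apply: (@holds_rename _ _ _ _ c) => //; exact: tnth_pair.
have E0 z : tnth [tuple z; val (f x); val (f y)] ord0 = z by [].
have E1 z : tnth [tuple z; val (f x); val (f y)] (inord 1) = val (f x).
  by rewrite (tnth_nth z) inordK.
have E2 z : tnth [tuple z; val (f x); val (f y)] (inord 2) = val (f y).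
  by rewrite (tnth_nth z) inordK.
have nuE z : holds (G := ColoredGraph (oapp c X)) (vertex_formula (ord0 : 'I_3))
    [tuple z; val (f x); val (f y)]
    = holds (G := ColoredGraph c) (nu J) [tuple z].
  by apply: holds_rename => // i; rewrite (ord1 i).
have etaE z : holds (G := ColoredGraph (oapp c X))
    (adj_formula (inord 1 : 'I_3) ord0) [tuple z; val (f x); val (f y)]
    = holds (G := ColoredGraph c) (eta J) [tuple val (f x); z].
  by apply: holds_rename => //; exact: tnth_pair.
have walkE z : holds (G := ColoredGraph (oapp c X))
    (rename id (walk_formula k) (pair_var (ord0 : 'I_3) (inord 2)))
    [tuple z; val (f x); val (f y)]
    = holds (G := ColoredGraph (oapp c X)) (walk_formula k) [tuple z; val (f y)].
  by apply: holds_rename => //; exact: tnth_pair.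
(* A witness satisfying [nu J] is a vertex of the interpreted graph, and [g] pulls it back to
   [S]. *)
apply/existsP/existsP => -[z].
  rewrite nuE etaE walkE => /andP[/andP[nz zX] /andP[xz zy]].
  pose z' : interpret J (ColoredGraph c) := exist _ z nz.
  exists (g z'); rewrite -IHk -Xold -fadj gK.
  by apply/and3P; split.
case/and3P=> zold xz zy; exists (val (f z)).
rewrite nuE etaE walkE IHk E0 /= Xold zold zy (valP (f z)) /= andbT.
by move: xz; rewrite -fadj.
Qed.

End Recover.

Definition recover_transduction (n : nat) (T : transduction) : transduction :=
  Transduction (copies_gt0 T) (recover_interpretation (interp T) n.+1).

Lemma recover_subdivision n (T : transduction) (D : sgraph -> Prop) H :
  transduction_image T D (subdiv n H) ->
  transduction_image (recover_transduction n T) D H.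
Proof.
case: T => k k0 U J [G DG [c [f fbij fadj]]] /=.
exists G => //=.
(* The new color is the image of the original vertices; the other colors are kept. *)
pose X : {set copy k G} := [set val (f (inl a)) | a : H].
exists (oapp c X).
have finj := bij_inj fbij; have [g fK gK] := fbij.
have Xold x : (val (f x) \in X) = original x.
  apply/imsetP/idP => [[a _ /val_inj/finj->]//|].
  by case: x => // a _; exists a.
have nuE x : holds (G := ColoredGraph (oapp c X)) (recover_nu J) [tuple x]
    = holds (G := ColoredGraph c) (nu J) [tuple x] && (x \in X).
  congr (_ && _); apply: (@holds_rename _ _ _ _ c) => // i.
  by rewrite (ord1 i).
have v a : holds (G := ColoredGraph (oapp c X)) (recover_nu J)
    [tuple val (f (inl a))].
  by rewrite nuE Xold andbT; exact: (valP (f (inl a))).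
pose h a : interpret (recover_interpretation J n.+1) (ColoredGraph (oapp c X)) :=
  exist _ (val (f (inl a))) (v a).
have hinj : injective h by move=> a b [/val_inj/finj[]].
exists h.
  have hsurj y : exists a, h a = y.
    have := valP y; rewrite nuE => /andP[_ /imsetP[a _ ya]].
    by exists a; apply: val_inj.
  have [h' h'K] := fin_all_exists hsurj.
  by exists h' => //; apply: inj_can_sym.
move=> a b; rewrite [LHS]holds_recover_eta !(holds_walk_formula _ _ _ fbij fadj Xold).
rewrite (inj_eq val_inj) (inj_eq hinj).
apply/andP/idP => [[ab /orP[]/inner_walk_adj]|ab].
- exact.
- by rewrite adj_sym eq_sym; apply.
- by split; [apply: contraL ab => /eqP[->]; rewrite adj_irr | rewrite adj_inner_walk].
Qed.

(** * Average degrees and depth-[r] minors of sparse graphs *)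

Lemma average_degree_le (H : sgraph) (d : nat) :
  \sum_(x : H) degree x <= d * #|H| -> (average_degree H <= d%:R)%R.
Proof.
rewrite /average_degree => le.
have [->|H0] := posnP #|H|; first by rewrite GRing.invr0 GRing.mulr0 Num.Theory.ler0n.
by rewrite Num.Theory.ler_pdivrMr ?Num.Theory.ltr0n // -GRing.natrM Num.Theory.ler_nat.
Qed.

Lemma sum_degree (G : sgraph) :
  \sum_(x : G) degree x = #|[set p : G * G | adj p.1 p.2]|.
Proof.
rewrite -sum1dep_card -(pair_big_dep predT (@adj G) (fun _ _ => 1)) /=.
by apply: eq_bigr => x _; rewrite /degree -sum1dep_card.
Qed.

Lemma card_bigcup_le (I T : finType) (A : {set I}) (F : I -> {set T}) (d : nat) :
  (forall i, i \in A -> #|F i| <= d) -> #|\bigcup_(i in A) F i| <= d * #|A|.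
Proof.
move=> Fd; rewrite mulnC -sum_nat_const.
elim/big_ind2: _ => [|a X b Y Xa Yb|i iA]; rewrite ?cards0 //; last exact: Fd.
by rewrite (leq_trans (leq_card_setU X Y)) ?leq_add.
Qed.

(** Ball growth: adding all neighbors inside [A] multiplies the size by at most [d + 1], and [r]
    rounds from the center exhaust [A]. *)
Lemma card_connected_le (G : sgraph) (d r : nat) (A : {set G}) :
  (forall x, x \in A -> degree x <= d) -> connected_radius_le r A ->
  #|A| <= d.+1 ^ r.
Proof.
move=> Ad [c cA Ac].
pose step (X : {set G}) := X :|: \bigcup_(x in X) [set y in A | adj x y].
have stepA j : iter j step [set c] \subset A.
  elim: j => [|j IHj] /=; first by rewrite sub1set.
  rewrite subUset IHj; apply/bigcupsP => x _; apply/subsetP => y.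
  by rewrite inE => /andP[].
have cardS j : #|iter j step [set c]| <= d.+1 ^ j.
  elim: j => [|j IHj]; first by rewrite cards1.
  rewrite iterS expnS (leq_trans (leq_card_setU _ _)) //.
  have := leq_mul (leqnn d.+1) IHj; apply: leq_trans.
  rewrite mulSn leq_add2l card_bigcup_le // => x xS.
  rewrite (leq_trans _ (Ad x (subsetP (stepA j) x xS))) //.
  by apply/subset_leq_card/subsetP => y; rewrite !inE => /andP[].
have mono j k : j <= k -> iter j step [set c] \subset iter k step [set c].
  move=> /subnK <-; elim: (k - j) => // i IHi.
  by rewrite addSn /= (subset_trans IHi) // subsetUl.
apply: leq_trans (cardS r); apply/subset_leq_card/subsetP => v /Ac[p [cp <- pr]].
apply: (subsetP (mono _ _ pr)).
elim/last_ind: p cp {pr} => [|p y IHp] /=; first by rewrite inE.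
rewrite rcons_path last_rcons size_rcons => /andP[/IHp lp /and3P[_ yA ly]].
by rewrite inE; apply/orP; right; apply/bigcupP; exists (last c p); rewrite ?inE ?yA.
Qed.

Lemma connected_radius_walk (G : sgraph) (r : nat) (A : {set G}) x y :
  connected_radius_le r A -> x \in A -> y \in A ->
  exists p, [/\ path (@adj G) x p, last x p = y & size p <= r.*2].
Proof.
move=> [c cA Ac] /Ac[p [cp lp sp]] /Ac[q [cq lq sq]].
have sub : subrel (fun x y : G => [&& x \in A, y \in A & adj x y]) (@adj G).
  by move=> u v /and3P[].
(* The walk from the center to [x], reversed, followed by the one from the center to [y]. *)
exists (rev (belast c p) ++ q).
have rp : path (@adj G) x (rev (belast c p)).
  rewrite -lp rev_path; apply: sub_path cp => u v /and3P[_ _].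
  by rewrite adj_sym.
have lr : last x (rev (belast c p)) = c.
  by case: (p) lp => [|z s] //=; rewrite rev_cons last_rcons.
split; rewrite ?cat_path ?rp ?last_cat ?lr //=; first exact: sub_path cq.
by rewrite size_cat size_rev size_belast; lia.
Qed.

(* [S] plays the role of the original vertices of an [n.+1]-subdivision. *)
Definition sparse (n : nat) (G : sgraph) : Prop :=
  exists2 S : {set G}, (forall x, x \notin S -> degree x <= 2) &
    forall x y p, x \in S -> y \in S -> x != y ->
      path (@adj G) x p -> last x p = y -> n.+1 < size p.

Lemma sparse_iso n (G H : sgraph) : graph_iso G H -> sparse n G -> sparse n H.
Proof.
move=> [f [g fK gK] fadj] [S Sdeg Sfar].
have gadj x y : adj (g x) (g y) = adj x y by rewrite -fadj !gK.
have ginj := can_inj gK.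
exists [set y | g y \in S] => [y|x y p]; rewrite !inE.
  move/Sdeg; apply: leq_trans; rewrite /degree.
  rewrite -(card_imset _ ginj); apply/subset_leq_card/subsetP => z /imsetP[w].
  by rewrite !inE => yw ->; rewrite gadj.
move=> xS yS xy xp lp; rewrite -(size_map g).
apply: Sfar xS yS _ _ _; rewrite ?(inj_eq ginj) //; last by rewrite last_map lp.
rewrite path_map; apply: sub_path xp => u v; by rewrite /= gadj.
Qed.

Lemma subdiv_sparse n H : sparse n (subdiv n H).
Proof.
exists [set u | original u] => [u|u v p]; rewrite !inE.
  exact: degree_subdivision_vertex.
by move=> uo vo uv; exact: original_far.
Qed.

(** Every edge of the minor has an end whose block avoids [S]. Such a block has at most [3 ^ r]
    vertices of degree at most 2, hence at most [2 * 3 ^ r] neighboring blocks; the factor 4 comes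
    from counting ordered pairs by either end. *)
Lemma sparse_minor n r (G H : sgraph) :
  sparse n G -> r * 4 <= n -> depth_minor r H G ->
  (average_degree H <= (4 * 3 ^ r)%:R)%R.
Proof.
move=> [S Sdeg Sfar] rn [P [Ppart Prad [f finj fadj]]].
have [/eqP Pcov Ptriv P0] := and3P Ppart.
pose big (B : contract P) := [exists x in val B, x \in S].
have far B C : adj B C -> ~~ (big B && big C).
  case/andP=> BC /exists_inP[x xB /exists_inP[y yC xy]]; apply/negP.
  case/andP=> /exists_inP[s sB sS] /exists_inP[t tC tS].
  have [p [sp lp p2]] := connected_radius_walk (Prad _ (valP B)) sB xB.
  have [q [yq lq q2]] := connected_radius_walk (Prad _ (valP C)) yC tC.
  have st : s != t.
    apply: contraNneq BC => st; apply/eqP/val_inj.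
    rewrite -(def_pblock Ptriv (valP B) sB) st.
    exact: (def_pblock Ptriv (valP C) tC).
  (* This walk has at most [2r + 1 + 2r] edges, thus at most [n + 1], too few to link two elements
     of [S]. *)
  have := Sfar s t (p ++ y :: q) sS tS st.
  rewrite cat_path last_cat size_cat /= lp xy sp yq lq => /(_ erefl erefl).
  by move: p2 q2 rn; clear; lia.
have small B : ~~ big B -> degree B <= 2 * 3 ^ r.
  move=> Bsmall.
  have Bdeg x : x \in val B -> degree x <= 2.
    move=> xB; apply: Sdeg; apply: contra Bsmall => xS.
    by apply/exists_inP; exists x.
  have cB := card_connected_le Bdeg (Prad _ (valP B)).
  pose N := \bigcup_(x in val B) [set y | adj x y].
  have cN : #|N| <= 2 * 3 ^ r.
    by rewrite (leq_trans (card_bigcup_le Bdeg)) // leq_mul2l cB.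
  (* Each neighboring block is the [pblock] of some vertex of [N]. *)
  apply: leq_trans cN; apply: leq_trans (leq_imset_card (pblock P) N).
  rewrite /degree -(card_imset _ val_inj).
  apply/subset_leq_card/subsetP => X /imsetP[C].
  rewrite inE => /andP[_ /exists_inP[x xB /exists_inP[y yC xy]]] ->.
  apply/imsetP; exists y; last by rewrite (def_pblock Ptriv (valP C) yC).
  by apply/bigcupP; exists x; rewrite ?inE.
have smallH x : ~~ big (f x) -> degree x <= 2 * 3 ^ r.
  move/small; apply: leq_trans; rewrite /degree -(card_imset _ finj).
  apply/subset_leq_card/subsetP => z /imsetP[w]; rewrite !inE => xw ->.
  exact: fadj.
apply: average_degree_le; rewrite sum_degree.
pose E := [set p : H * H | ~~ big (f p.1) && adj p.1 p.2].
have cE : #|E| <= 2 * 3 ^ r * #|H|.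
  have -> : E = \bigcup_(x in [set x | ~~ big (f x)]) pair x @: [set y | adj x y].
    apply/setP=> -[x y]; rewrite !inE; apply/andP/bigcupP => /= [[xs xy]|[z]].
      by exists x; rewrite ?inE //; apply/imsetP; exists y; rewrite ?inE.
    by rewrite inE => zs /imsetP[w]; rewrite inE => zw [-> ->].
  rewrite (leq_trans (card_bigcup_le (d := 2 * 3 ^ r) _)) //.
    by move=> x; rewrite inE => /smallH; apply: leq_trans; apply: leq_imset_card.
  by rewrite leq_mul2l max_card orbT.
(* Adjacent pairs whose second component has a block avoiding [S]; together with [E] they cover all
   adjacent pairs. *)
pose E' := (fun p : H * H => (p.2, p.1)) @: E.
have -> : 4 * 3 ^ r * #|H| = 2 * 3 ^ r * #|H| + 2 * 3 ^ r * #|H|.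
  by rewrite -!mulnDl.
apply: leq_trans (leq_add cE (leq_trans (leq_imset_card _ _) cE : #|E'| <= _)).
apply: leq_trans (leq_card_setU _ _).
apply/subset_leq_card/subsetP => -[x y]; rewrite !inE /= => xy.
rewrite xy andbT; case: (boolP (big (f x))) => //= bx.
apply/imsetP; exists (y, x) => //; rewrite inE /= adj_sym xy andbT.
by have := far _ _ (fadj _ _ xy); rewrite bx.
Qed.

(** Crude bound for the exceptional graphs: blocks are subsets of [G], so the minor has at most
    [#|{set G}|] vertices. *)
Lemma average_degree_minor_card r (G H : sgraph) :
  depth_minor r H G -> (average_degree H <= #|{set G}|%:R)%R.
Proof.
move=> [P [_ _ [f finj _]]]; apply: average_degree_le.
have HG : #|H| <= #|{set G}|.
  exact: leq_card (inj_comp val_inj finj).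
rewrite (leq_trans (_ : _ <= \sum_(x : H) #|{set G}|)) //; last first.
  by rewrite sum_nat_const mulnC.
by apply: leq_sum => x _; rewrite (leq_trans (max_card _)).
Qed.

(** * The diagonal class and the conclusion *)

(** The size bound leaves finitely many graphs up to isomorphism for each [n], and the condition is
    invariant under isomorphism. *)
Definition sparse_class_mem (N : nat -> nat) (G : sgraph) : Prop :=
  exists2 n, sparse n G & #|{set G}| <= N n.

Lemma sparse_class_iso N (G H : sgraph) :
  graph_iso G H -> sparse_class_mem N G -> sparse_class_mem N H.
Proof.
move=> GH [n sG GN]; exists n; first exact: sparse_iso sG.
have [f fbij _] := GH; apply: leq_trans GN.
by rewrite -!cardsT -!powersetT !card_powerset !cardsT (bij_eq_card fbij).
Qed.

Lemma bounded_expansion_sparse (N : nat -> nat) (C : graph_class) :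
  (forall G, C G -> exists2 n, sparse n G & #|{set G}| <= N n) ->
  bounded_expansion C.
Proof.
(* The first term serves [n >= 4r]; the sum absorbs the remaining values of [n]. *)
move=> CN; exists (fun r => 4 * 3 ^ r + \sum_(n < r * 4) N n) => r G H.
move=> /CN[n sG GN] minor.
have [rn|nr] := leqP (r * 4) n.
  apply: Order.POrderTheory.le_trans (sparse_minor sG rn minor) _.
  by rewrite Num.Theory.ler_nat leq_addr.
apply: Order.POrderTheory.le_trans (average_degree_minor_card minor) _.
rewrite Num.Theory.ler_nat (leq_trans GN) // (bigD1 (Ordinal nr)) //=.
by rewrite addnCA leq_addr.
Qed.

Theorem proposition20p5 :
  (forall C : graph_class, bounded_expansion C -> fo_le C all_graphs) /\
  (forall B : graph_class,
     (forall C : graph_class, bounded_expansion C -> fo_le C B) ->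
     fo_equiv B all_graphs).
Proof.
split=> [C _|B Bub]; first exact: fo_le_subclass.
split; first exact: fo_le_subclass.
apply: NNPP => noB.
have [en enP] := transduction_enumeration.
have ex n : exists H, ~ transduction_image (recover_transduction n (en n)) B H.
  apply: not_all_ex_not => all; apply: noB.
  by exists (recover_transduction n (en n)) => G _; exact: all.
pose H n := sval (constructive_indefinite_description _ (ex n)).
have HP n : ~ transduction_image (recover_transduction n (en n)) B (H n).
  exact: svalP (constructive_indefinite_description _ (ex n)).
(* Exactly the bound that admits the [n]-th subdivision. *)
pose N n := #|{set subdiv n (H n)}|.
have C0 : sparse_class_mem N empty_graph.
  exists 0; first by exists set0 => [[]|x y p]; rewrite ?inE.
  rewrite /N -!cardsT -!powersetT !card_powerset !cardsT.
  by rewrite leq_pexp2l // card_void.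
pose C := GraphClass (@sparse_class_iso N) C0.
have [T TP] := Bub C (bounded_expansion_sparse (fun G (CG : C G) => CG)).
(* Diagonal argument: [en n] would produce [subdiv n (H n)] from [B], against the choice of
   [H n]. *)
have [n enT] := enP T.
apply: (HP n); apply: recover_subdivision; apply/enT/TP.
by exists n; first exact: subdiv_sparse.
Qed.
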